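(* Let $U$ and $Z$ be as defined below. Then $Z\,U^{-1}$ is a sum of basis elements $\mathbf G_\pi$ without multiplicities (every coefficient is $0$ or $1$), and for every $n\ge1$ the number of signed permutations of size $n$ occurring in it equals the number of type $D$ snakes of size $n$, namely the number of signed permutations $\pi$ of size $n$ with $0<\pi_1<\pi_2>\pi_3<\pi_4>\cdots$. Moreover, $(1+Z)\,U^{-1}$ is also a sum of basis elements $\mathbf G_\pi$ without multiplicities, and for every $n\ge0$ the number of signed permutations of size $n$ occurring in it equals the number of alternating signed permutations of size $n$, i.e. those with $\pi_1<\pi_2>\pi_3<\pi_4>\cdots$.
   Context: A signed permutation of size $n$ is a word $\pi=\pi_1\cdots\pi_n$ over the integers such that $|\pi_1|,\dots,|\pi_n|$ is a permutation of $\{1,\dots,n\}$ (written $(\sigma,\epsilon)$, $\pi_i=\epsilon_i\sigma(i)$); $-k$ is written $\bar k$; letters are compared as integers. For a word $w$ of distinct integers, $\mathrm{std}(w)$ is the permutation with the same relative order. ${\bf FQSym}^{(2)}$ is the algebra with basis $\mathbf G_{(\sigma,\epsilon)}$ indexed by signed permutations of all sizes (unit $\mathbf G_\emptyset=1$), with product $\mathbf{G}_{(\alpha,\epsilon)}\mathbf{G}_{(\beta,\eta)}=\sum_{\gamma}\mathbf{G}_{(\gamma,\epsilon\cdot\eta)}$, the sum over $\gamma\in\mathfrak S_{k+l}$ with $\mathrm{std}(\gamma_1\cdots\gamma_k)=\alpha$, $\mathrm{std}(\gamma_{k+1}\cdots\gamma_{k+l})=\beta$ ($k,l$ the sizes),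 $\epsilon\cdot\eta$ the concatenation; formal infinite sums are allowed. Let $\tau_{2m}$ be the signed permutation of size $2m$ with $|\tau_{2m}|$ the identity and $\tau_{2m}(i)<0$ iff $i$ is even, and $\rho_{2m+1}$ the signed permutation of size $2m+1$ with $|\rho_{2m+1}|$ the identity and $\rho_{2m+1}(i)<0$ iff $i$ is odd and $i\ge3$. Set $U=1+\sum_{m\ge1}(-1)^m\mathbf G_{\tau_{2m}}-\sum_{m\ge0}(-1)^m\mathbf G_{\rho_{2m+1}}=1-[\mathbf G_1+\mathbf G_{1\bar2}-\mathbf G_{12\bar3}-\mathbf G_{1\bar23\bar4}+\cdots]$. For $n\ge1$ let $\zeta_n$ be the signed permutation of size $n$ with $|\zeta_n|$ the identity, $\zeta_n(1)=\bar1$, $\zeta_n(2)=2$ (if $n\ge2$), and for $3\le i\le n$, $\zeta_n(i)<0$ iff $n-i$ is even. Let $c_n\in\{\pm1\}$ be the sign of the coefficient of $z^n$ in $\cos z+\sin z-1$ (so $c_n=+1$ if $n\equiv0,1\pmod4$ and $c_n=-1$ if $n\equiv2,3\pmod 4$), and set $Z=\sum_{n\ge1}c_n\mathbf G_{\zeta_n}=\mathbf G_{\bar1}-\mathbf G_{\bar12}-\mathbf G_{\bar12\bar3}+\mathbf G_{\bar123\bar4}+\mathbf G_{\bar12\bar34\bar5}-\cdots$. *)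

(* Defs.v *)
From HB Require Import structures.
From mathcomp Require Import all_boot all_order all_fingroup all_algebra.
From mathcomp Require Import zify.
From mathcomp Require Import boolp.

Set Implicit Arguments.
Unset Strict Implicit.
Unset Printing Implicit Defensive.
Import Order.TTheory GRing.Theory Num.Theory.
Local Open Scope ring_scope.

(* [(s, e)] is the signed permutation with letters e_i s(i); [e i = true] means
   that the i-th letter is negative. Positions and values are 0-based in 'I_n. *)
Definition sperm (n : nat) : Type := ('S_n * {ffun 'I_n -> bool})%type.

Section SignedPermutations.
Variable n : nat.
Implicit Type p : sperm n.

Definition letter p (i : 'I_n) : int := (-1) ^+ p.2 i * (p.1 i).+1%:Z.

(* |p| as a word over {1, ..., n} *)
Definition absword p : seq nat := [seq (p.1 i).+1 | i <- enum 'I_n].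
Definition signs p : seq bool := [seq p.2 i | i <- enum 'I_n].

(* pi_1 < pi_2 > pi_3 < ...: the condition on consecutive positions i, j = i + 1,
   the 0-based position i being even when the usual one is odd *)
Definition alternating p : bool :=
  [forall i : 'I_n, forall j : 'I_n, (j == i.+1 :> nat) ==>
     (if odd i then letter p j < letter p i else letter p i < letter p j)].

Definition snakeD p : bool :=
  alternating p && [forall i : 'I_n, (i == 0%N :> nat) ==> (0 < letter p i)].

(* |p| is the identity; [neg i] tells whether the letter in the usual, 1-based,
   position i is negative *)
Definition signed_id (neg : nat -> bool) : sperm n :=
  (1%g, [ffun i : 'I_n => neg i.+1]).

End SignedPermutations.

(* each letter is replaced by its rank; meant for words without repetition *)
Definition std (w : seq nat) : seq nat := [seq count (leq^~ x) w | x <- w].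

(* G_p occurs in the product G_a G_b *)
Definition in_prod k l n (a : sperm k) (b : sperm l) (p : sperm n) : bool :=
  [&& std (take k (absword p)) == absword a,
      std (drop k (absword p)) == absword b
    & signs p == signs a ++ signs b].

(* Formal, possibly infinite, linear combinations of the G_p: the completion of
   FQSym^(2) with respect to the size of signed permutations. *)
Record fqsym2 (K : fieldType) := FQSym2 { coef : forall n, sperm n -> K }.

Section Algebra.
Variable K : fieldType.
Local Notation A := (fqsym2 K).
Implicit Types f g h : A.

HB.instance Definition _ := gen_eqMixin A.
HB.instance Definition _ := gen_choiceMixin A.

Lemma fqsym2P f g : (forall n (p : sperm n), coef f p = coef g p) -> f = g.
Proof.
case: f g => [f] [g] /= fg; congr FQSym2.
by apply: functional_extensionality_dep => n; apply/funext => p; apply: fg.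
Qed.

Definition fqadd f g : A := FQSym2 (fun n p => @coef _ f n p + @coef _ g n p).
Definition fqopp f : A := FQSym2 (fun n p => - @coef _ f n p).
Definition fqscale (c : K) f : A := FQSym2 (fun n p => c * @coef _ f n p).
Definition fq0 : A := FQSym2 (fun _ _ => 0).
Definition fq1 : A := FQSym2 (fun n _ => (n == 0%N)%:R).

(* The bilinear extension of the product of the G_p. A sum G_a G_b only has
   terms of size k + l, where k and l are the sizes of a and b. *)
Definition fqmul f g : A := FQSym2 (fun n p =>
  \sum_(k < n.+1) \sum_(a : sperm k) \sum_(b : sperm (n - k))
    (coef f a * coef g b) *+ in_prod a b p).

Fact fqaddA : associative fqadd.
Proof. by move=> f g h; apply: fqsym2P => n p; rewrite /= addrA. Qed.
Fact fqaddC : commutative fqadd.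
Proof. by move=> f g; apply: fqsym2P => n p; rewrite /= addrC. Qed.
Fact fqadd0 : left_id fq0 fqadd.
Proof. by move=> f; apply: fqsym2P => n p; rewrite /= add0r. Qed.
Fact fqaddN : left_inverse fq0 fqopp fqadd.
Proof. by move=> f; apply: fqsym2P => n p; rewrite /= addNr. Qed.

HB.instance Definition _ :=
  GRing.isZmodule.Build A fqaddA fqaddC fqadd0 fqaddN.

Fact fqscaleA a b f : fqscale a (fqscale b f) = fqscale (a * b) f.
Proof. by apply: fqsym2P => n p; rewrite /= mulrA. Qed.
Fact fqscale1 : left_id 1 fqscale.
Proof. by move=> f; apply: fqsym2P => n p; rewrite /= mul1r. Qed.
Fact fqscaleDr : right_distributive fqscale +%R.
Proof. by move=> a f g; apply: fqsym2P => n p; rewrite /= mulrDr. Qed.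
Fact fqscaleDl f : {morph fqscale^~ f : a b / a + b}.
Proof. by move=> a b; apply: fqsym2P => n p; rewrite /= mulrDl. Qed.

HB.instance Definition _ :=
  GRing.Zmodule_isLmodule.Build K A fqscaleA fqscale1 fqscaleDr fqscaleDl.

Lemma size_absword n (p : sperm n) : size (absword p) = n.
Proof. by rewrite size_map size_enum_ord. Qed.

Lemma size_signs n (p : sperm n) : size (signs p) = n.
Proof. by rewrite size_map size_enum_ord. Qed.

Lemma absword_inj n (p q : sperm n) :
  absword p = absword q -> signs p = signs q -> p = q.
Proof.
case: p q => [s e] [t d] /eq_in_map st /eq_in_map ed; congr pair.
  by apply/permP => i; apply/val_inj/succn_inj/st; rewrite mem_enum.
by apply/ffunP => i; apply: ed; rewrite mem_enum.
Qed.

Lemma size_std w : size (std w) = size w.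
Proof. exact: size_map. Qed.

Lemma std_mono (c : nat -> nat) w :
  {in w &, {mono c : x y / (x <= y)%N}} -> std (map c w) = std w.
Proof.
move=> cm; rewrite /std -map_comp; apply/eq_in_map => x xw /=.
by rewrite count_map; apply: eq_in_count => y yw /=; apply: cm.
Qed.


Lemma count_leq_mono (w : seq nat) :
  {in w &, {mono (fun x => count (leq^~ x) w) : x y / (x <= y)%N}}.
Proof.
move=> x y xw yw; apply/idP/idP => [|xy]; last first.
  by apply: sub_count => z /leq_trans; apply.
apply: contraTT; rewrite -!ltnNge => yx.
have x0 : (0 < count (pred1 x) w)%N by rewrite -has_count has_pred1.
have := count_predUI (leq^~ y) (pred1 x) w.
rewrite [X in (_ + X)%N](_ : _ = 0%N); last first.
  apply/eqP; rewrite -leqn0 leqNgt -has_count; apply/hasPn => z _ /=.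
  by apply/negP => /andP[+ /eqP zx]; rewrite zx leqNgt yx.
have : (count (predU (leq^~ y) (pred1 x)) w <= count (leq^~ x) w)%N.
  by apply: sub_count => z /= /orP[/leq_trans->//|/eqP->//]; apply: ltnW.
by rewrite addn0 => + e; rewrite e; apply: leq_trans; rewrite -[X in (X <= _)%N]addn1 leq_add2l.
Qed.

Lemma std_take_std j w : std (take j (std w)) = std (take j w).
Proof.
rewrite -map_take std_mono// => x y /mem_take xw /mem_take yw.
exact: count_leq_mono.
Qed.

Lemma std_drop_std j w : std (drop j (std w)) = std (drop j w).
Proof.
rewrite -map_drop std_mono// => x y /mem_drop xw /mem_drop yw.
exact: count_leq_mono.
Qed.

Lemma absword_uniq n (p : sperm n) : uniq (absword p).
Proof.
rewrite map_inj_uniq ?enum_uniq// => i j [/val_inj]; exact: perm_inj.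
Qed.

Lemma std_absword n (p : sperm n) : std (absword p) = absword p.
Proof.
have pe : perm_eq (absword p) (iota 1 n).
  apply: uniq_perm; rewrite ?iota_uniq ?absword_uniq// => x.
  rewrite mem_iota; apply/mapP/idP => [[i _ ->]|/andP[x0 xn]].
    by rewrite add1n !ltnS leq0n ltn_ord.
  have xn' : (x.-1 < n)%N by lia.
  exists ((p.1^-1)%g (Ordinal xn')); rewrite ?mem_enum// permKV /=; lia.
rewrite -[RHS]map_id; apply/eq_in_map => x; rewrite (perm_mem pe) mem_iota.
move=> /andP[x0 xn]; rewrite (seq.permP pe).
rewrite -size_filter (_ : [seq _ <- _ | _] = iota 1 x) ?size_iota//.
rewrite (_ : n = x + (n - x))%N; last by lia.
rewrite iotaD filter_cat (_ : [seq _ <- iota 1 x | _] = iota 1 x); last first.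
  by apply/all_filterP/allP => y; rewrite mem_iota /=; lia.
rewrite (_ : [seq _ <- _ | _] = [::]) ?cats0//.
apply/eqP; rewrite -(negbK (_ == _)) -has_filter; apply/hasPn => y.
rewrite mem_iota /=; lia.
Qed.

Lemma std_ex n (u : seq nat) (s : seq bool) :
  uniq u -> size u = n -> size s = n ->
  exists p : sperm n, absword p = std u /\ signs p = s.
Proof.
move=> uu su ss; pose c x := count (leq^~ x) u.
have c0 i : (i < n)%N -> (0 < c (nth 0%N u i))%N.
  move=> ni; rewrite -has_count; apply/hasP; exists (nth 0%N u i) => //=.
  by rewrite mem_nth ?su.
have cn (i : 'I_n) : ((c (nth 0%N u i)).-1 < n)%N.
  have := count_size (leq^~ (nth 0%N u i)) u; rewrite su -/(c _).
  have := c0 _ (ltn_ord i); lia.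
have ci : injective (fun i => Ordinal (cn i)).
  move=> i j [] cij; apply/val_inj/eqP.
  rewrite -(nth_uniq 0%N _ _ uu) ?su ?ltn_ord//.
  have {}cij : c (nth 0%N u i) = c (nth 0%N u j).
    by have := c0 _ (ltn_ord i); have := c0 _ (ltn_ord j); lia.
  have mu (k : 'I_n) : nth 0%N u k \in u by rewrite mem_nth ?su.
  have le (k l : 'I_n) : (nth 0%N u k <= nth 0%N u l)%N =
      (c (nth 0%N u k) <= c (nth 0%N u l))%N.
    by rewrite [RHS](count_leq_mono (mu k) (mu l)).
  by rewrite eqn_leq !le cij leqnn.
exists (perm ci, [ffun i : 'I_n => nth false s i]); split.
  apply: (@eq_from_nth _ 0%N); rewrite size_absword ?size_std// => i ni.
  rewrite (nth_map (Ordinal ni)) ?size_enum_ord// permE /=.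
  rewrite (nth_map 0%N) ?su// (nth_enum_ord (Ordinal ni))// prednK//; exact: c0.
apply: (@eq_from_nth _ false); rewrite size_signs ?ss// => i ni.
by rewrite (nth_map (Ordinal ni)) ?size_enum_ord// ffunE (nth_enum_ord (Ordinal ni)).
Qed.

(* the coefficient of the signed permutation with absolute value std u and signs s *)
Definition wcoef_ f n u s : K :=
  \sum_(a : sperm n) coef f a *+ ((std u == absword a) && (s == signs a)).
Definition wcoef f u s : K := wcoef_ f (size u) u s.

Lemma wcoef_E f n u s : size u = n -> wcoef_ f n u s = wcoef f u s.
Proof. by move=> <-. Qed.

Lemma wcoefP f n (p : sperm n) u s :
  std u = absword p -> s = signs p -> wcoef f u s = coef f p.
Proof.
move=> up sp; rewrite -(@wcoef_E f n); last by rewrite -size_std up size_absword.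
rewrite /wcoef_ (bigD1 p)//= up sp !eqxx mulr1n big1 ?addr0// => q qp.
case: eqP => //= aq; case: eqP => // sq.
by move: qp; rewrite -(absword_inj aq sq) eqxx.
Qed.

Lemma coefM f g n (p : sperm n) : coef (fqmul f g) p =
  \sum_(k < n.+1) wcoef f (take k (absword p)) (take k (signs p)) *
                  wcoef g (drop k (absword p)) (drop k (signs p)).
Proof.
apply: eq_bigr => k _.
rewrite -(@wcoef_E f k); last by rewrite size_takel// size_absword -ltnS.
rewrite -(@wcoef_E g (n - k)); last by rewrite size_drop size_absword.
rewrite big_distrlr /=; apply: eq_bigr => a _; apply: eq_bigr => b _.
rewrite mulrnAl mulrnAr -mulrnA mulnb; congr (_ *+ nat_of_bool _).
rewrite /in_prod -[X in X == _ ++ _](cat_take_drop k).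
rewrite eqseq_cat; first by rewrite [RHS]andbACA andbA andbC -!andbA; do !bool_congr.
by rewrite size_takel ?size_signs// -ltnS.
Qed.

Lemma wcoefM f g u s : uniq u -> size s = size u ->
  wcoef (fqmul f g) u s = \sum_(k < (size u).+1)
     wcoef f (take k u) (take k s) * wcoef g (drop k u) (drop k s).
Proof.
move=> uu su; have [p [pu ps]] := std_ex uu (erefl _) su.
rewrite (wcoefP _ (esym pu) (esym ps)) coefM pu ps.
have wE h v t w : std v = std w -> wcoef h v t = wcoef h w t.
  by move=> vw; rewrite /wcoef /wcoef_ -(size_std v) vw size_std.
by apply: eq_bigr => k _; congr (_ * _); apply: wE;
  rewrite ?std_take_std ?std_drop_std.
Qed.

Lemma coef_wcoef f n (p : sperm n) : coef f p = wcoef f (absword p) (signs p).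
Proof. by rewrite (@wcoefP f n p) ?std_absword. Qed.

Fact fqmulA : associative fqmul.
Proof.
move=> f g h; apply: fqsym2P => n p; rewrite !coefM.
set u := absword p; set s := signs p.
have su : size u = n by rewrite size_absword.
have ss : size s = n by rewrite size_signs.
have uu : uniq u := absword_uniq p.
pose T i j := wcoef f (take i u) (take i s) *
  (wcoef g (take (j - i) (drop i u)) (take (j - i) (drop i s)) *
   wcoef h (drop j u) (drop j s)).
transitivity (\sum_(i < n.+1) \sum_(j < n.+1 | (i <= j)%N) T i j).
  apply: eq_bigr => i _.
  have ni : (i <= n)%N by rewrite -ltnS.
  rewrite wcoefM ?drop_uniq ?size_drop ?ss ?su// big_distrr /=.
  rewrite -(big_mkord predT (fun k => wcoef f (take i u) (take i s) *
    (wcoef g (take k (drop i u)) (take k (drop i s)) *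
     wcoef h (drop k (drop i u)) (drop k (drop i s))))).
  rewrite -(big_mkord (fun j => i <= j)%N (T i)).
  rewrite [RHS](big_cat_nat _ (n := i))//=; last by rewrite ltnW.
  rewrite [X in _ = X + _]big_nat_cond [X in _ = X + _]big1 ?add0r; last first.
    by move=> j; lia.
  rewrite big_nat_cond [RHS]big_nat_cond [RHS](big_addn 0 n.+1 i) subSn//.
  apply: eq_big => [k|k _]; first by lia.
  by rewrite /T addnK !drop_drop.
rewrite (exchange_big_dep predT)//=; apply: eq_bigr => j _.
have nj : (j <= n)%N by rewrite -ltnS.
rewrite wcoefM ?take_uniq ?size_takel ?ss ?su// big_distrl /=.
rewrite -(big_mkord (fun i => i <= j)%N (fun i => T i j)).
rewrite -(big_mkord predT (fun k =>
  wcoef f (take k (take j u)) (take k (take j s)) *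
  wcoef g (drop k (take j u)) (drop k (take j s)) *
  wcoef h (drop j u) (drop j s))).
rewrite (big_cat_nat _ (n := j.+1))//=.
rewrite [X in _ + X]big_nat_cond [X in _ + X]big1 ?addr0; last first.
  by move=> i; lia.
rewrite big_nat_cond [RHS]big_nat_cond; apply: eq_big => [i|i]; first by lia.
move=> ij; have {}ij : (i <= j)%N by lia.
by rewrite /T mulrA !take_takel// !take_drop subnK.
Qed.

Lemma wcoef1 u s : size s = size u -> uniq u -> wcoef fq1 u s = (size u == 0%N)%:R.
Proof.
move=> su uu; have [p [pu ps]] := std_ex uu (erefl _) su.
by rewrite (@wcoefP fq1 _ p).
Qed.

Fact fqmul1 : left_id fq1 fqmul.
Proof.
move=> f; apply: fqsym2P => n p; rewrite coefM big_ord_recl big1 ?addr0 => [|i _].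
  by rewrite wcoef1 ?take0// mul1r !drop0 -coef_wcoef.
rewrite wcoef1 ?take_uniq ?absword_uniq//; last first.
  by rewrite !size_take size_signs size_absword.
by rewrite size_takel ?size_absword -1?ltnS ?ltn_ord//= mul0r.
Qed.

Fact fqmulr1 : right_id fq1 fqmul.
Proof.
move=> f; apply: fqsym2P => n p; rewrite coefM big_ord_recr /= big1 ?add0r => [|i _].
  rewrite wcoef1 ?drop_oversize ?size_absword ?size_signs//= mulr1.
  by rewrite !take_oversize ?size_absword ?size_signs// -coef_wcoef.
rewrite wcoef1 ?drop_uniq ?absword_uniq//; last first.
  by rewrite !size_drop size_signs size_absword.
rewrite size_drop size_absword /= (_ : _ == _ = false) ?mulr0//.
by have := ltn_ord i; lia.
Qed.

Fact fqmulDl : left_distributive fqmul +%R.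
Proof.
move=> f g h; apply: fqsym2P => n p /=; rewrite -big_split /=.
apply: eq_bigr => k _; rewrite -big_split /=; apply: eq_bigr => a _.
by rewrite -big_split /=; apply: eq_bigr => b _; rewrite mulrDl mulrnDl.
Qed.

Fact fqmulDr : right_distributive fqmul +%R.
Proof.
move=> f g h; apply: fqsym2P => n p /=; rewrite -big_split /=.
apply: eq_bigr => k _; rewrite -big_split /=; apply: eq_bigr => a _.
by rewrite -big_split /=; apply: eq_bigr => b _; rewrite mulrDr mulrnDl.
Qed.

(* the empty signed permutation *)
Definition sperm0 : sperm 0 := (1%g, [ffun => false]).

Lemma sperm0P (p : sperm 0) : p = sperm0.
Proof. apply: absword_inj.
  by rewrite !(size0nil (size_absword _)).
by rewrite !(size0nil (size_signs _)).
Qed.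

Fact fq1_neq0 : fq1 != 0.
Proof.
by apply/eqP => /(congr1 (fun f => coef f sperm0)) /eqP; rewrite /= oner_eq0.
Qed.

HB.instance Definition _ := GRing.Zmodule_isNzRing.Build A
  fqmulA fqmul1 fqmulr1 fqmulDl fqmulDr fq1_neq0.

Fact fqscaleAl (a : K) f g : a *: (f * g) = (a *: f) * g.
Proof.
apply: fqsym2P => n p /=; rewrite !mulr_sumr; apply: eq_bigr => k _.
rewrite mulr_sumr; apply: eq_bigr => x _; rewrite mulr_sumr.
by apply: eq_bigr => y _; rewrite mulrnAr mulrA.
Qed.

HB.instance Definition _ := GRing.Lmodule_isLalgebra.Build K A fqscaleAl.

Fact fqscaleAr (a : K) f g : a *: (f * g) = f * (a *: g).
Proof.
apply: fqsym2P => n p /=; rewrite !mulr_sumr; apply: eq_bigr => k _.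
rewrite mulr_sumr; apply: eq_bigr => x _; rewrite mulr_sumr.
by apply: eq_bigr => y _; rewrite mulrnAr mulrCA.
Qed.

HB.instance Definition _ := GRing.Lalgebra_isAlgebra.Build K A fqscaleAr.

Lemma coef_mul f g n (p : sperm n) : coef (f * g) p =
  \sum_(k < n.+1) wcoef f (take k (absword p)) (take k (signs p)) *
                  wcoef g (drop k (absword p)) (drop k (signs p)).
Proof. exact: coefM. Qed.

Lemma coef_mul0 f g : coef (f * g) sperm0 = coef f sperm0 * coef g sperm0.
Proof.
rewrite coef_mul big_ord1 !take0 !drop0 -coef_wcoef; congr (_ * _).
by apply: wcoefP; rewrite ?(size0nil (size_absword _)) ?(size0nil (size_signs _)).
Qed.

Lemma coef_mul_low f g h n (p : sperm n) : coef f sperm0 = 0 ->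
  (forall m (q : sperm m), (m < n)%N -> coef g q = coef h q) ->
  coef (f * g) p = coef (f * h) p.
Proof.
move=> f0 gh; apply: eq_bigr => -[[|k] kn] _; apply: eq_bigr => a _ /=;
  apply: eq_bigr => b _.
  by rewrite [a]sperm0P f0 !mul0r.
by rewrite gh//; lia.
Qed.

(* f is invertible iff its constant term c is nonzero; its inverse g is the
   fixpoint of g |-> c^-1 (1 - (f - c) g), computed size by size. *)
Definition fqunit : {pred A} := fun f => coef f sperm0 != 0.

Definition fqinv_step f g : A :=
  (coef f sperm0)^-1 *: (1 - (f - (coef f sperm0)%:A) * g).

Definition fqinv_def f : A :=
  FQSym2 (fun n p => @coef _ (iter n.+1 (fqinv_step f) 0) n p).

Definition fqinv f : A := if f \in fqunit then fqinv_def f else f.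

Lemma fqinv_step_low f g h n (p : sperm n) :
  (forall m (q : sperm m), (m < n)%N -> coef g q = coef h q) ->
  coef (fqinv_step f g) p = coef (fqinv_step f h) p.
Proof.
move=> gh; congr (_ * (_ - _)); apply: coef_mul_low => //=.
by rewrite mulr1 subrr.
Qed.

Lemma fqinv_def_fix f : fqinv_step f (fqinv_def f) = fqinv_def f.
Proof.
have step m n (p : sperm n) : (n < m)%N ->
    coef (iter m (fqinv_step f) 0) p = coef (iter m.+1 (fqinv_step f) 0) p.
  elim: m n p => // m IHm n p nm; rewrite iterS [in RHS]iterS.
  by apply: fqinv_step_low => k q kn; apply: IHm; lia.
have stab m n (p : sperm n) : (n < m)%N ->
    coef (iter m (fqinv_step f) 0) p = coef (fqinv_def f) p.
  elim: m => // m IHm; rewrite ltnS leq_eqVlt => /predU1P[nm|nm].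
    by subst m.
  by rewrite -step// IHm.
apply: fqsym2P => n p; transitivity (coef (fqinv_step f (iter n (fqinv_step f) 0)) p); last by [].
by apply: fqinv_step_low => m q mn; rewrite stab.
Qed.

Lemma fqmul_inv f : f \in fqunit -> f * fqinv_def f = 1.
Proof.
move=> fu; have := fqinv_def_fix f; rewrite {1}/fqinv_step.
move=> /(congr1 (fun g => coef f sperm0 *: g)).
rewrite scalerA mulfV// scale1r mulrBl -scalerAl mul1r opprB.
by move=> /eqP; rewrite addrCA -subr_eq0 addrAC subrr add0r subr_eq0 eq_sym => /eqP.
Qed.

Lemma fqinv_unit f : f \in fqunit -> fqinv_def f \in fqunit.
Proof.
move=> fu; have := congr1 (fun g => coef g sperm0) (fqmul_inv fu).
rewrite coef_mul0 => /eqP.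
by apply: contraTN => /eqP->; rewrite mulr0 eq_sym oner_eq0.
Qed.

Fact fqmulVr : {in fqunit, left_inverse 1 fqinv *%R}.
Proof.
move=> f fu; rewrite /fqinv fu; set g := fqinv_def f.
have fg : f * g = 1 by apply: fqmul_inv.
have gh := fqmul_inv (fqinv_unit fu).
by rewrite -[X in _ * X]mulr1 -gh (mulrA f) fg mul1r.
Qed.

Fact fqmulrV : {in fqunit, right_inverse 1 fqinv *%R}.
Proof. by move=> f fu; rewrite /fqinv fu fqmul_inv. Qed.

Fact fqunitP f g : g * f = 1 /\ f * g = 1 -> f \in fqunit.
Proof.
move=> [_ /(congr1 (fun h => coef h sperm0))]; rewrite coef_mul0 /= => /eqP.
by apply: contraTN => /eqP->; rewrite mul0r eq_sym oner_eq0.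
Qed.

Fact fqinv_out : {in [predC fqunit], fqinv =1 id}.
Proof. by move=> f /negbTE fu; rewrite /fqinv [_ \in _]fu. Qed.

HB.instance Definition _ := GRing.NzRing_hasMulInverse.Build A
  fqmulVr fqmulrV fqunitP fqinv_out.

(* Basis elements; a and q may have different sizes. *)
Definition G m (a : sperm m) : A :=
  FQSym2 (fun n q => (Tagged sperm q == Tagged sperm a)%:R).

Lemma coef_G n (a q : sperm n) : coef (G a) q = (q == a)%:R.
Proof. by rewrite /= eq_Tagged. Qed.

Lemma coef_G_word m n (a : sperm m) (q : sperm n) :
  coef (G a) q = ((absword q == absword a) && (signs q == signs a))%:R.
Proof.
congr (nat_of_bool _)%:R; have [mn|mn] := eqVneq m n.
  subst m; rewrite eq_Tagged /=; apply/eqP/andP => [->//|[/eqP aq /eqP sq]].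
  exact: absword_inj.
rewrite (_ : _ == _ = false); last first.
  by apply/negbTE; apply: contraNN mn => /eqP/(congr1 tag)/= ->.
apply/esym/negbTE; rewrite negb_and; apply/orP; left.
by apply: contraNN mn => /eqP/(congr1 size); rewrite !size_absword => ->.
Qed.

(* [in_prod] does describe the product of two basis elements *)
Lemma coef_GM k l n (a : sperm k) (b : sperm l) (p : sperm n) :
  coef (G a * G b) p = (in_prod a b p)%:R.
Proof.
have wG m (c : sperm m) u s : uniq u -> size s = size u ->
    wcoef (G c) u s = ((std u == absword c) && (s == signs c))%:R.
  move=> uu su; have [q [qu qs]] := std_ex uu (erefl _) su.
  by rewrite (@wcoefP _ _ q)// coef_G_word qu qs.
rewrite coef_mul.
have E j : (j <= n)%N ->
  wcoef (G a) (take j (absword p)) (take j (signs p)) *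
  wcoef (G b) (drop j (absword p)) (drop j (signs p)) =
  ((j == k) && in_prod a b p)%:R.
  move=> jn; rewrite !wG ?take_uniq ?drop_uniq ?absword_uniq//; last 2 first.
  - by rewrite !size_drop size_absword size_signs.
  - by rewrite !size_take size_absword size_signs.
  rewrite -natrM mulnb /in_prod; congr (nat_of_bool _)%:R.
  have [jk|jk] := eqVneq j k; last first.
    apply/negbTE; apply: contraNN jk => /andP[/andP[/eqP + _] _].
    by move=> /(congr1 size); rewrite size_std size_takel size_absword// => ->.
  subst j; rewrite -[in RHS](cat_take_drop k (signs p)) eqseq_cat.
    by rewrite andTb -!andbA; do !bool_congr.
  by rewrite size_takel size_signs.
rewrite (eq_bigr _ (fun (j : 'I_n.+1) _ => E j (ltn_ord j))).
have [kn|kn] := ltnP k n.+1.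
  rewrite (bigD1 (Ordinal kn))//= eqxx big1 ?addr0// => j.
  by rewrite -val_eqE /= => /negbTE->.
rewrite big1 => [|j _]; last by rewrite ltn_eqF// (leq_trans _ kn).
rewrite /in_prod (_ : _ == _ = false)//; apply/eqP => /(congr1 size).
by rewrite size_std size_take !size_absword; case: ifP; lia.
Qed.

End Algebra.

Section Series.
Variable K : fieldType.

(* the formal sum of the c n *: G (p n), whose only term of size n is the n-th one *)
Definition gseries (c : nat -> K) (p : forall n, sperm n) : fqsym2 K :=
  FQSym2 (fun n q => c n * coef (G K (p n)) q).

Definition tau n : sperm n := signed_id n (fun i => ~~ odd i).
Definition rho n : sperm n := signed_id n (fun i => odd i && (3 <= i)%N).
Definition zeta n : sperm n :=
  signed_id n (fun i => (i == 1%N) || (3 <= i)%N && ~~ odd (n - i)).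

Definition U : fqsym2 K :=
  1 + gseries (fun n => if (0 < n)%N && ~~ odd n then (-1) ^+ n./2 else 0) tau
    - gseries (fun n => if odd n then (-1) ^+ n./2 else 0) rho.

(* the coefficients are the signs of those of cos z + sin z - 1 *)
Definition Z : fqsym2 K :=
  gseries (fun n => if n == 0%N then 0
                    else if (n %% 4 < 2)%N then 1 else -1) zeta.

(* hence U^-1 is a genuine inverse, by mulVr and divrr *)
Lemma U_unit : U \is a GRing.unit.
Proof.
change (coef U sperm0 != 0); rewrite /= !mul0r addr0 subr0; exact: oner_neq0.
Qed.

Definition occurring (f : fqsym2 K) n : {set sperm n} :=
  [set p : sperm n | coef f p != 0].

Definition multiplicity_free (f : fqsym2 K) : Prop :=
  forall n (p : sperm n), coef f p = 0 \/ coef f p = 1.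

End Series.

(* Main.v *)
(* Cut a signed word into parts "+" and ascending parts "+ -". The blocks of
   1 - U are the increasing words made of one part followed by parts "+ -", each
   join costing a factor -1. In U^-1 a part "+ -" thus is either cut from what
   precedes it (factor 1) or joined to it (factor -1, for an ascent): only the
   descents survive. A word determines its parts, so all coefficients are 0 or 1:
   a word occurs in U^-1 iff each negative letter follows a positive letter whose
   absolute value is a valley, with infinity before the first letter. Likewise the
   words of Z U^-1 start with a negative letter which is alone or is the start of
   a descent "- +", the condition on the other negative letters being unchanged.

   On the other side a signed permutation alternates iff, in each pair of adjacent
   letters, the one with the larger absolute value has the sign prescribed by its
   position. For a fixed |pi| the number of signs of both kinds is computed by the
   same recursion along the word, after exchanging k and n + 1 - k. *)

Require Import Defs.
From mathcomp Require Import all_boot all_order all_fingroup all_algebra.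
From mathcomp Require Import zify ring.
Import Order.TTheory GRing.Theory Num.Theory.
Local Open Scope ring_scope.

Set Implicit Arguments.
Unset Strict Implicit.
Unset Printing Implicit Defensive.

(** * Local conditions on signed words *)

Notation sword := (seq (nat * bool)).

(* [x] is the absolute value of the previous letter, and [f] tells whether that
   letter is positive and preceded by no letter or by a descent. *)
Fixpoint valley_ok (r : rel nat) (x : nat) (f : bool) (w : sword) : bool :=
  if w is (a, s) :: w' then
    if s then [&& f, r x a & valley_ok r a false w']
    else valley_ok r a (~~ r x a) w'
  else true.

Definition inv_ok r (w : sword) : bool :=
  if w is (a, s) :: w' then ~~ s && valley_ok r a true w' else true.

Definition quo_ok (r : rel nat) (w : sword) : bool :=
  if w is (a, s) :: w' then
    s && (if w' is (b, t) :: w'' then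
            [&& ~~ t, ~~ r a b & valley_ok r b true w'']
          else true)
  else false.

(** Absolute values are read only through the relation. This serves for standardisation and for
    complementation of values, which exchanges [ltn] and [gtn]. *)
Lemma valley_ok_map (c : nat -> nat) (r r' : rel nat) x f u s :
  {in x :: u &, forall y z, r' (c y) (c z) = r y z} ->
  valley_ok r' (c x) f (zip (map c u) s) = valley_ok r x f (zip u s).
Proof.
elim: u x f s => [|a u IH] x f [|b s] //= cr.
rewrite cr ?mem_head ?inE ?eqxx ?orbT // !IH // => y z yu zu;
  by apply: cr; rewrite inE (yu, zu) orbT.
Qed.

Lemma inv_ok_map (c : nat -> nat) (r r' : rel nat) u s :
  {in u &, forall y z, r' (c y) (c z) = r y z} ->
  inv_ok r' (zip (map c u) s) = inv_ok r (zip u s).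
Proof. by case: u s => [|a u] [|b s] //= cr; rewrite (valley_ok_map (r := r)). Qed.

Lemma quo_ok_map (c : nat -> nat) (r r' : rel nat) u s :
  {in u &, forall y z, r' (c y) (c z) = r y z} ->
  quo_ok r' (zip (map c u) s) = quo_ok r (zip u s).
Proof.
case: u s => [|a u] [|b s] //=; case: u s => [|d u] [|e s] //= cr.
rewrite cr ?mem_head ?inE ?eqxx ?orbT // (valley_ok_map (r := r)) // => y z yu zu.
by apply: cr; rewrite inE (yu, zu) orbT.
Qed.

Definition altsig n := [seq odd i | i <- iota 0 n].

Lemma altsigSS n : altsig n.+2 = [:: false, true & altsig n].
Proof.
rewrite /altsig /= (iotaDl 2 0) -map_comp; congr [:: _, _ & _].
by apply: eq_map => i /=; rewrite negbK.
Qed.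

Lemma altsigN n : [seq ~~ odd i | i <- iota 1 n] = altsig n.
Proof. by rewrite (iotaDl 1 0) -map_comp; apply: eq_map => i /=; rewrite negbK. Qed.

Lemma altsigS n : altsig n.+1 = false :: [seq ~~ odd i | i <- iota 0 n].
Proof. by rewrite /altsig /= (iotaDl 1 0) -map_comp. Qed.

Lemma std_sorted (u : seq nat) :
  uniq u -> (std u == iota 1 (size u)) = sorted ltn u.
Proof.
move=> uu; rewrite ltn_sorted_uniq_leq uu /=.
have -> : sorted leq u = sorted leq (std u).
  rewrite /std sorted_map; apply: (@eq_in_sorted _ (mem u)).
    by move=> x y xu yu /=; rewrite count_leq_mono.
  exact/allP.
apply/eqP/idP => [->|su]; first exact: iota_sorted.
apply: (@sorted_eq _ leq leq_trans anti_leq) => //; first exact: iota_sorted.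
(* Here [std_ex] only serves to see [std u] as a permutation word; the signs are arbitrary. *)
have [p [<- _]] := std_ex uu (erefl _) (size_nseq (size u) false).
apply: uniq_perm; rewrite ?absword_uniq ?iota_uniq// => x.
have [|||_ ->] // := @uniq_min_size _ (absword p) (iota 1 (size u)).
- exact: absword_uniq.
- by move=> y /mapP[i _ ->]; rewrite mem_iota; have := ltn_ord (p.1 i); lia.
by rewrite size_absword size_iota.
Qed.

Lemma map_iota1 (T : Type) (f : nat -> T) n :
  [seq f i | i <- iota 1 n] = [seq f i.+1 | i : 'I_n].
Proof. by rewrite (iotaDl 1 0) -val_enum_ord -(map_comp f) -(map_comp _ val). Qed.

(** * Convolution of functions on words, and the cancellation of ascents *)

Section Coefficients.
Variable K : fieldType.

Definition conv (f g : sword -> K) (w : sword) : K :=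
  \sum_(k < (size w).+1) f (take k w) * g (drop k w).

Lemma conv_nil f g : conv f g [::] = f [::] * g [::].
Proof. by rewrite /conv big_ord1. Qed.

Lemma conv_cons f g x w :
  conv f g (x :: w) = f [::] * g (x :: w) + conv (fun v => f (x :: v)) g w.
Proof. by rewrite /conv big_ord_recl. Qed.

Lemma convD f1 f2 g w :
  conv (fun v => f1 v + f2 v) g w = conv f1 g w + conv f2 g w.
Proof. by rewrite /conv -big_split; apply: eq_bigr => k _; rewrite mulrDl. Qed.

Lemma convZ c f g w : conv (fun v => c * f v) g w = c * conv f g w.
Proof. by rewrite /conv mulr_sumr; apply: eq_bigr => k _; rewrite mulrA. Qed.

Lemma convN f g w : conv (fun v => - f v) g w = - conv f g w.
Proof. by rewrite /conv -sumrN; apply: eq_bigr => k _; rewrite mulNr. Qed.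

Lemma conv0 g w : conv (fun=> 0) g w = 0.
Proof. by rewrite /conv big1 // => k _; rewrite mul0r. Qed.

(* The signed contribution of w as a sequence of parts "+ -" continuing an
   increasing block that ends with x. *)
Fixpoint pairs (x : nat) (w : sword) : K :=
  match w with
  | [::] => 1
  | (a, false) :: (b, true) :: w' => - (x < a < b)%N%:R * pairs b w'
  | _ => 0
  end.

(* The coefficients of U and Z; the second term is the block starting with a part
   of size two. *)
Definition Uword (w : sword) : K :=
  match w with
  | [::] => 1
  | (a, false) :: w' => - (pairs a w' +
      (if w' is (b, true) :: w'' then (a < b)%N%:R * pairs b w'' else 0))
  | _ => 0
  end.

Definition Zword (w : sword) : K :=
  match w with
  | (a, true) :: w' => pairs a w' -
      (if w' is (b, false) :: w'' then (a < b)%N%:R * pairs b w'' else 0)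
  | _ => 0
  end.

Lemma pairsE x u s : size s = size u -> pairs x (zip u s) =
  if odd (size u) then 0
  else (-1) ^+ (size u)./2 *+ (path ltn x u && (s == altsig (size u))).
Proof.
have [n] := ubnP (size u); elim: n x u s => // n IH x [|a [|b u]] [|p [|q s]] //=.
  by case: p.
move=> nu [us]; rewrite altsigSS !eqseq_cons negbK.
case: p => /=; first by rewrite !andbF if_same.
case: q => /=; last by rewrite !andbF if_same.
rewrite IH //; last by lia.
by case: odd; case: (x < a)%N; case: (a < b)%N;
  rewrite /= ?mulr0 ?mulr0n ?mul0r ?oppr0 ?mul0r // exprS mulrnAr.
Qed.

(** On a word starting with + -, the empty block contributes with the condition [a < b], and joining
    the part contributes the opposite with [x < a < b]: a descent from [x] to [a] is left. On other
    words only the empty block contributes. *)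
Lemma conv_pairs x w :
  conv (pairs x) (fun v => (inv_ok ltn v)%:R) w = (valley_ok ltn x false w)%:R.
Proof.
have [n] := ubnP (size w); elim: n x w => // n IH x [|[a s] [|[b t] w]] /=.
- by move=> _; rewrite conv_nil mulr1.
- by move=> _; rewrite conv_cons conv_nil /=; case: s; rewrite mul1r mul0r addr0.
move=> nw; rewrite !conv_cons /=.
case: s => /=; first by rewrite conv0 !mul1r !mul0r !addr0.
case: t => /=; last by rewrite conv0 !mul1r !mul0r !addr0.
rewrite convZ IH; last by lia.
case: (x < a)%N; case: (a < b)%N; case: valley_ok; rewrite /=; ring.
Qed.

(** The two values of the flag of [valley_ok] differ only before a negative letter, by exactly the
    ascending part + - that the second term of [Uword] removes. *)
Lemma conv_U w :
  conv Uword (fun v => (inv_ok ltn v)%:R) w = (size w == 0%N)%:R.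
Proof.
case: w => [|[a s] w]; first by rewrite conv_nil mulr1.
rewrite conv_cons /= mul1r; case: s => /=; first by rewrite conv0 addr0.
rewrite convN convD conv_pairs.
case: w => [|[b t] w]; first by rewrite conv_nil mul0r addr0 subrr.
rewrite conv_cons /=; case: t => /=; last by rewrite conv0; ring.
rewrite convZ conv_pairs; case: (a < b)%N; case: valley_ok; rewrite /=; ring.
Qed.

(** For a start - +, the two terms of [Zword] cancel on an ascent of absolute values; on a descent
    the first one alone gives [valley_ok b true]. *)
Lemma conv_Z w :
  conv Zword (fun v => (inv_ok ltn v)%:R) w = (quo_ok ltn w)%:R.
Proof.
case: w => [|[a s] w]; first by rewrite conv_nil mul0r.
rewrite conv_cons /= mul0r add0r; case: s => /=; last by rewrite conv0.
rewrite convD convN conv_pairs.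
case: w => [|[b t] w]; first by rewrite conv_nil /=; ring.
rewrite conv_cons /=; case: t => /=; first by rewrite conv0; ring.
rewrite convZ conv_pairs; case: (a < b)%N; rewrite /=; ring.
Qed.

(** * The series [U] and [Z] read on words *)

Lemma wcoefD (f g : fqsym2 K) u s : wcoef (f + g) u s = wcoef f u s + wcoef g u s.
Proof.
by rewrite /wcoef /wcoef_ -big_split; apply: eq_bigr => a _; exact: mulrnDl.
Qed.

Lemma wcoefN (f : fqsym2 K) u s : wcoef (- f) u s = - wcoef f u s.
Proof.
by rewrite /wcoef /wcoef_ -sumrN; apply: eq_bigr => a _; exact: mulNrn.
Qed.

Lemma wcoef_gseries c (neg : nat -> nat -> bool) u s :
  uniq u -> size s = size u ->
  wcoef (gseries c (fun n => signed_id n (neg n)) : fqsym2 K) u s =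
  c (size u) *+ (sorted ltn u && (s == [seq neg (size u) i | i <- iota 1 (size u)])).
Proof.
move=> uu su; have [p [pu ps]] := std_ex uu (erefl _) su.
rewrite (wcoefP _ (esym pu) (esym ps)).
rewrite -[LHS]/(_ * coef (G K (signed_id _ (neg _))) p) coef_G_word pu ps.
have -> : absword (signed_id (size u) (neg (size u))) = iota 1 (size u).
  by rewrite -[RHS]map_id map_iota1; apply: eq_map => i; rewrite /= perm1.
have -> : signs (signed_id (size u) (neg (size u))) =
    [seq neg (size u) i | i <- iota 1 (size u)].
  by rewrite map_iota1; apply: eq_map => i; rewrite /= ffunE.
by rewrite std_sorted // mulr_natr.
Qed.

Lemma wcoef_U u s : uniq u -> size s = size u -> wcoef (U K) u s = Uword (zip u s).
Proof.
move=> uu su; rewrite !wcoefD wcoefN wcoef1 //.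
rewrite (wcoef_gseries _ (fun _ i => ~~ odd i)) //.
rewrite (wcoef_gseries _ (fun _ i => odd i && (3 <= i)%N)) //.
case: u s su uu => [|a u] [|x s] //=; first by rewrite !mul0rn !addr0 subr0.
move=> [su] _; rewrite add0r.
rewrite !eqseq_cons.
(* In even size [tau] consists of parts + -; in odd size [rho] is a + followed by such parts. *)
have -> : [seq ~~ odd i | i <- iota 2 (size u)] = [seq ~~ odd i | i <- iota 0 (size u)].
  by rewrite (iotaDl 2) -map_comp; apply: eq_map => i /=; rewrite negbK.
have -> : [seq odd i && (2 < i)%N | i <- iota 2 (size u)] = altsig (size u).
  rewrite /altsig (iotaDl 2) -map_comp; apply: eq_map => i /=.
  by case: i => [|i] //=; rewrite !negbK andbT.
case: x => /=; first by rewrite !andbF !mulr0n subr0.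
rewrite pairsE //; case: u s su => [|b u] [|t s] //=.
  by move=> _; rewrite addr0 sub0r.
move=> [su]; rewrite !negbK altsigS altsigN !eqseq_cons.
case: t => /=; last first.
  rewrite andbF sub0r addr0 uphalf_half.
  by case: odd; rewrite /= ?mul0rn // oppr0.
rewrite pairsE // andbF mulr0n if_same add0r.
case: (odd (size u)) => /=; first by rewrite !(mul0rn, mulr0, subrr, oppr0).
rewrite subr0 exprS mulN1r mulNrn -andbA -mulnb.
by rewrite mulr_natl -mulrnA mulnC.
Qed.

Lemma wcoef_Z u s : uniq u -> size s = size u -> wcoef (Z K) u s = Zword (zip u s).
Proof.
move=> uu su.
rewrite (wcoef_gseries _ (fun n i => (i == 1%N) || (3 <= i)%N && ~~ odd (n - i))) //.
case: u s su uu => [|a u] [|x s] //=.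
move=> [su] _; rewrite !eqseq_cons; case: x => /=; last by rewrite andbF.
have -> : ((if ((size u).+1 %% 4 < 2)%N then 1 else -1) : K) = (-1) ^+ uphalf (size u).
  rewrite -signr_odd; have -> : ((size u).+1 %% 4 < 2)%N = ~~ odd (uphalf (size u)) by lia.
  by case: odd.
(* In odd size [zeta] is a - followed by parts + -, in even size a part - + followed by parts + -;
   its size is [(size u).+1]. *)
have -> : [seq (i == 1%N) || (2 < i)%N && ~~ odd ((size u).+1 - i)
             | i <- iota 2 (size u)] =
  if odd (size u) then false :: altsig (size u).-1 else altsig (size u).
  case: u su => [|b u] //= _.
  case: ifP => ou.
    congr (_ :: _); rewrite /altsig (iotaDl 3 0) -map_comp.
    apply/eq_in_map => i; rewrite mem_iota /=; lia.
  rewrite altsigS /=; congr (_ :: _); rewrite (iotaDl 3 0) -map_comp.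
  apply/eq_in_map => i; rewrite mem_iota /=; lia.
rewrite pairsE //; case: u s su => [|b u] [|t s] //=.
  by move=> _; rewrite subr0.
move=> [su]; rewrite altsigS.
rewrite pairsE //; case: t => /=.
  by case: odd; rewrite /= !eqseq_cons /= ?andbF subr0.
rewrite uphalf_half; case: odd; rewrite /= !eqseq_cons /= ?mulr0 ?subr0 // sub0r.
by rewrite mulr_natl -mulrnA mulnC mulnb andbA exprS mulN1r mulNrn.
Qed.


Lemma zip_take_drop (A B : Type) k (u : seq A) (s : seq B) :
  zip (take k u) (take k s) = take k (zip u s) /\
  zip (drop k u) (drop k s) = drop k (zip u s).
Proof.
elim: k u s => [|k IH] [|a u] [|b s] //=; rewrite ?drop0 //.
- by split=> //; case: (drop k s).
- by split; [case: (take k u) | case: (drop k u)].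
by have [-> ->] := IH u s.
Qed.

Definition spword n (p : sperm n) : sword := zip (absword p) (signs p).

Definition Uinv : fqsym2 K := FQSym2 (fun n p => (inv_ok ltn (spword p))%:R).

Lemma wcoef_Uinv u s : uniq u -> size s = size u ->
  wcoef Uinv u s = (inv_ok ltn (zip u s))%:R.
Proof.
move=> uu su; have [p [pu ps]] := std_ex uu (erefl _) su.
rewrite (wcoefP _ (esym pu) (esym ps)) /= /spword pu ps.
rewrite (inv_ok_map (r := ltn)) // => x y xu yu /=.
by rewrite ltnNge count_leq_mono // ltnNge.
Qed.

Lemma coef_mul_Uinv (f : fqsym2 K) F n (p : sperm n) :
  (forall u s, uniq u -> size s = size u -> wcoef f u s = F (zip u s)) ->
  coef (f * Uinv) p = conv F (fun w => (inv_ok ltn w)%:R) (spword p).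
Proof.
move=> fF; rewrite coef_mul /conv size1_zip size_absword ?size_signs //.
apply: eq_bigr => k _; have [<- <-] := zip_take_drop k (absword p) (signs p).
rewrite fF ?wcoef_Uinv ?take_uniq ?drop_uniq ?absword_uniq //.
  by rewrite !size_drop size_absword size_signs.
by rewrite !size_take size_absword size_signs.
Qed.

(** As [U] is a unit, it can be cancelled on the left, so [conv_U] suffices. *)
Lemma U_inv : (U K)^-1 = Uinv.
Proof.
apply: (mulrI (U_unit K)); rewrite divrr ?U_unit //; apply: fqsym2P => n p.
rewrite (coef_mul_Uinv _ wcoef_U) conv_U size1_zip size_absword ?size_signs //.
Qed.

Lemma coef_Uinv n (p : sperm n) : coef (U K)^-1 p = (inv_ok ltn (spword p))%:R.
Proof. by rewrite U_inv. Qed.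

Lemma coef_ZUinv n (p : sperm n) :
  coef (Z K * (U K)^-1) p = (quo_ok ltn (spword p))%:R.
Proof. by rewrite U_inv (coef_mul_Uinv _ wcoef_Z) conv_Z. Qed.

Lemma coef_1ZUinv n (p : sperm n) : coef ((1 + Z K) * (U K)^-1) p =
  (inv_ok ltn (spword p) || quo_ok ltn (spword p))%:R.
Proof.
rewrite mulrDl mul1r -[LHS]/(coef (U K)^-1 p + coef (Z K * (U K)^-1) p).
(* The sign of the first letter separates the two supports; the empty word lies only in the
   first. *)
rewrite coef_Uinv coef_ZUinv; case: (spword p) => [|[a []] w] /=; first exact: addr0.
  by rewrite add0r.
by rewrite addr0 orbF.
Qed.

End Coefficients.

(** * Alternating words and the number of sign choices *)

Definition letter_int (l : nat * bool) : int := (-1) ^+ l.2 * l.1%:Z.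

Lemma letter_intE a s : letter_int (a, s) = if s then - a%:Z else a%:Z.
Proof. by case: s; rewrite /letter_int ?expr1 ?expr0 ?mulN1r ?mul1r. Qed.

Fixpoint alt (d : bool) (x : nat * bool) (w : sword) : bool :=
  if w is y :: w' then
    (if d then letter_int y < letter_int x else letter_int x < letter_int y)
    && alt (~~ d) y w'
  else true.

Definition alternating_word (w : sword) : bool :=
  if w is x :: w' then alt false x w' else true.

Definition snakeD_word (w : sword) : bool :=
  if w is x :: w' then (0 < letter_int x) && alt false x w' else true.

Definition signings n : seq (seq bool) :=
  iter n (fun l => [seq true :: s | s <- l] ++ [seq false :: s | s <- l]) [:: [::]].

Lemma mem_signings n s : (s \in signings n) = (size s == n).
Proof.
elim: n s => [|n IH] s; first by rewrite inE size_eq0.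
rewrite /= -/(signings n) mem_cat; case: s => [|b s] /=.
  by apply/orP => -[] /mapP[].
rewrite eqSS -IH; apply/orP/idP => [[] /mapP[t tn [_ ->]] //|sn].
by case: b; [left|right]; apply: map_f.
Qed.

Lemma uniq_signings n : uniq (signings n).
Proof.
elim: n => //= n IH; rewrite -/(signings n) cat_uniq.
rewrite !map_inj_uniq ?IH /= ?andbT; try by move=> s t [].
by apply/hasPn => _ /mapP[s _ ->]; apply/mapP => -[].
Qed.

Definition nsign (P : sword -> bool) (u : seq nat) : nat :=
  count (fun s => P (zip u s)) (signings (size u)).

Lemma nsign_cons P a u : nsign P (a :: u) =
  (nsign (fun w => P ((a, true) :: w)) u + nsign (fun w => P ((a, false) :: w)) u)%N.
Proof. by rewrite /nsign /= count_cat !count_map. Qed.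

Lemma eq_nsign P Q u : P =1 Q -> nsign P u = nsign Q u.
Proof. by move=> PQ; apply: eq_count => s; apply: PQ. Qed.

Lemma nsign_false u : nsign (fun=> false) u = 0%N.
Proof. exact: count_pred0. Qed.

Lemma nsign_and b P u : nsign (fun w => b && P w) u = (b * nsign P u)%N.
Proof. by case: b => /=; rewrite ?mul1n ?mul0n ?nsign_false. Qed.

Lemma card_spword n (P : sword -> bool) :
  #|[set p : sperm n | P (spword p)]| =
  (\sum_(s : 'S_n) nsign P (absword (s, [ffun=> false])))%N.
Proof.
rewrite -sum1_card big_mkcond.
rewrite (eq_bigr (fun p : sperm n => nat_of_bool (P (spword (p.1, p.2))))); last first.
  by move=> [s e] _; rewrite inE; case: (P _).
rewrite -(pair_bigA _ (fun s e => nat_of_bool (P (spword (s, e))))) /=.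
apply: eq_bigr => s _; rewrite /nsign size_absword.
have /seq.permP -> : perm_eq (signings n) [seq signs (s, e) | e : {ffun 'I_n -> bool}].
  rewrite perm_sym; apply: uniq_perm; last 1 first.
  - move=> t; rewrite mem_signings; apply/mapP/eqP => [[e _ ->]|tn].
      by rewrite size_signs.
    have [p [_ ps]] := std_ex (iota_uniq 0 n) (size_iota 0 n) tn.
    by exists p.2; rewrite ?mem_enum // -ps.
  - rewrite map_inj_uniq ?enum_uniq // => e1 e2 /eq_in_map e12.
    by apply/ffunP => i; apply: e12; rewrite mem_enum.
  - exact: uniq_signings.
rewrite count_map -sum1_count [RHS]big_mkcond [RHS]big_enum /=.
by apply: eq_bigr => e _; rewrite /spword; case: P.
Qed.

Lemma card_spword_rev n (P Q : sword -> bool) :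
  (forall u, uniq u -> {in u, forall x, 0 < x <= n}%N -> size u = n ->
     nsign P [seq (n.+1 - x)%N | x <- u] = nsign Q u) ->
  #|[set p : sperm n | P (spword p)]| = #|[set p : sperm n | Q (spword p)]|.
Proof.
move=> PQ; rewrite !card_spword.
(* Right multiplication by the reversal acts on values: [k] becomes [n.+1 - k]. *)
rewrite (reindex_inj (mulIg (perm (@rev_ord_inj n)))) /=.
apply: eq_bigr => s _.
rewrite -PQ ?absword_uniq ?size_absword //; last first.
  by move=> x /mapP[i _ ->]; rewrite /= ltn_ord.
congr (nsign P _); rewrite /absword -map_comp; apply: eq_map => i /=.
by rewrite permM permE /= subSn.
Qed.

(** The larger absolute value decides the comparison. If it is [b], its sign must be [d]; if it is
    [a], then [s] must differ from [d] and the sign of [b] is free. *)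
Lemma nsign_alt d a s u : uniq (a :: u) -> {in a :: u, forall x, 0 < x}%N ->
  nsign (alt d (a, s)) u =
  if u is b :: u' then
    if (a < b)%N then nsign (alt (~~ d) (b, d)) u'
    else ((s != d) * (nsign (alt (~~ d) (b, true)) u'
                     + nsign (alt (~~ d) (b, false)) u'))%N
  else 1%N.
Proof.
case: u => [|b u]; first by [].
rewrite /= inE negb_or => /andP[/andP[ab _] _] u0.
have a0 : (0 < a)%N by apply: u0; rewrite mem_head.
have b0 : (0 < b)%N by apply: u0; rewrite !inE eqxx orbT.
rewrite nsign_cons /= !nsign_and !letter_intE.
move: ab; rewrite neq_ltn; case: ltnP => [ab _|ab /= ba];
  case: d; case: s; rewrite /=;
  repeat (match goal with |- context [nat_of_bool (?x < ?y)%R] =>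
    first [have -> : (x < y)%R = true by lia | have -> : (x < y)%R = false by lia] end);
  by rewrite ?mul1n ?mul0n ?addn0 ?add0n.
Qed.

(* For a direction d of the next comparison, ~~ d is the sign of the previous
   letter that makes it succeed when the next letter is smaller in absolute value. *)
Lemma nsign_valley_alt d a u : uniq (a :: u) -> {in a :: u, forall x, 0 < x}%N ->
  nsign (valley_ok gtn a true) u = nsign (alt d (a, ~~ d)) u /\
  (2 * nsign (valley_ok gtn a false) u)%N =
    (nsign (alt d (a, true)) u + nsign (alt d (a, false)) u)%N.
Proof.
elim: u d a => [|b u IH] d a; first by [].
move=> uu u0; have /andP[au uu'] := uu.
have u0' : {in b :: u, forall x, 0 < x}%N by move=> x xu; apply: u0; rewrite inE xu orbT.
rewrite !(nsign_alt _ _ uu u0) /=; have [T F] := IH (~~ d) b uu' u0'; rewrite negbK in T.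
have ab : a != b by apply: contraNneq au => ->; rewrite mem_head.
rewrite !nsign_cons /= !nsign_and nsign_false -F -T.
set X := nsign (valley_ok gtn b true) u; set Y := nsign (valley_ok gtn b false) u.
(* If [a < b], the sign of [b] is forced and each sign of [a] counts [X]. If [b < a], only the sign
   [~~ d] of [a] is allowed, and it counts [2 * Y]. *)
move: ab; rewrite neq_ltn; case: ltnP => [ab _|ab /= ba].
  have -> : (b < a)%N = false by lia.
  by rewrite !mul0n !add0n mul2n addnn.
rewrite ba mul1n !add0n mul2n addnn -!mulnDl.
by case: d {T F}; rewrite /= ?add0n ?addn0 mul1n.
Qed.

(** From two letters on, both counts vanish unless [a < b]; then [b] is positive in a snake and
    [nsign_valley_alt] applies. The empty word is a snake but fails [quo_ok]. *)
Lemma nsign_snakeD u : uniq u -> {in u, forall x, 0 < x}%N -> (0 < size u)%N ->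
  nsign (quo_ok gtn) u = nsign snakeD_word u.
Proof.
case: u => [|a u] // uu u0 _.
have a0 : (0 < a)%N by apply: u0; rewrite mem_head.
rewrite !nsign_cons /= !nsign_and nsign_false !letter_intE.
have -> : (0 < - a%:Z) = false by lia.
have -> : 0 < a%:Z by lia.
rewrite mul0n addn0 add0n mul1n nsign_alt //; case: u uu u0 => [|b u] //= uu u0.
have /andP[au uu'] := uu.
have u0' : {in b :: u, forall x, 0 < x}%N by move=> x xu; apply: u0; rewrite inE xu orbT.
have ab : a != b by apply: contraNneq au => ->; rewrite mem_head.
rewrite nsign_cons /= !nsign_and nsign_false (nsign_valley_alt true uu' u0').1 /gtn /=.
by move: ab; rewrite neq_ltn; case: ltnP => //= ab ba; lia.
Qed.

(** First signs are exchanged: nonempty words of [inv_ok] start with + and match alternating words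
    starting with -, while those of [quo_ok] start with - and match the snakes. *)
Lemma nsign_alternating u : uniq u -> {in u, forall x, 0 < x}%N ->
  nsign (fun w => inv_ok gtn w || quo_ok gtn w) u = nsign alternating_word u.
Proof.
case: u => [|a u] // uu u0; have sn := nsign_snakeD uu u0 isT.
have a0 : (0 < a)%N by apply: u0; rewrite mem_head.
move: sn; rewrite !nsign_cons /= !nsign_false addn0.
rewrite (@eq_nsign (fun w => valley_ok gtn a true w || false)
                   (valley_ok gtn a true)); last by move=> w; rewrite orbF.
rewrite (nsign_valley_alt false uu u0).1 => ->; rewrite !nsign_and !letter_intE.
have -> : (0 < - a%:Z) = false by lia.
have -> : 0 < a%:Z by lia.
by rewrite mul0n mul1n addnC.
Qed.

(** * From conditions on positions to conditions on words *)

Lemma altP d x w : reflect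
  (forall i, (i < size w)%N ->
     if odd i (+) d then letter_int (nth x (x :: w) i.+1) < letter_int (nth x (x :: w) i)
     else letter_int (nth x (x :: w) i) < letter_int (nth x (x :: w) i.+1))
  (alt d x w).
Proof.
elim: w d x => [|y w IH] d x /=; first by constructor.
have nthE i : (i < size w)%N ->
    (nth y (y :: w) i = nth x (y :: w) i) * (nth y w i = nth x w i).
  by move=> iw; split; apply: set_nth_default; rewrite //= ltnW.
apply: (iffP andP) => [[xy /IH yw] [|i] //= iw|H].
  by have := yw i iw; rewrite /= addbN addNb !nthE.
split; first exact: (H 0%N).
apply/IH => i iw; have := H i.+1 iw.
by rewrite /= addbN addNb !nthE.
Qed.

Lemma spwordE n (p : sperm n) : spword p = [seq ((p.1 i).+1, p.2 i) | i <- enum 'I_n].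
Proof. by rewrite /spword /absword /signs; elim: (enum _) => //= i s ->. Qed.

Lemma size_spword n (p : sperm n) : size (spword p) = n.
Proof. by rewrite spwordE size_map size_enum_ord. Qed.

Lemma letter_nth n (p : sperm n) x (i : 'I_n) :
  letter_int (nth x (spword p) i) = letter p i.
Proof. by rewrite spwordE (nth_map i) ?size_enum_ord // nth_ord_enum. Qed.

Lemma alternating_spword n (p : sperm n) : alternating p = alternating_word (spword p).
Proof.
case: n p => [|n] p.
  rewrite (size0nil (size_spword p)) /=; apply/forallP => -[].
  by [].
have sp := size_spword p; have np := letter_nth p.
case: (spword p) sp np => // x w [sw] np /=; apply/idP/altP => [alt_p i iw|H].
  have i1 : (i < n.+1)%N by rewrite ltnS -sw ltnW.
  have i2 : (i.+1 < n.+1)%N by rewrite ltnS -sw.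
  move/forallP/(_ (Ordinal i1))/forallP/(_ (Ordinal i2)): alt_p.
  by rewrite /= eqxx /= addbF -!(np x).
apply/forallP => i; apply/forallP => j; apply/implyP => /eqP ij.
have iw : (i < size w)%N by rewrite sw -ltnS -ij.
by have := H i iw; rewrite addbF -ij !(np x).
Qed.

Lemma snakeD_spword n (p : sperm n) : snakeD p = snakeD_word (spword p).
Proof.
rewrite /snakeD alternating_spword.
case: n p => [|n] p.
  by rewrite (size0nil (size_spword p)) /=; apply/forallP => -[].
have sp := size_spword p; have := letter_nth p (0%N, false) ord0.
case: (spword p) sp => // x w _ /= ->; rewrite andbC; congr (_ && _).
apply/forallP/idP => [/(_ ord0) //|p0 i].
by apply/implyP => /eqP i0; rewrite (_ : i = ord0) //; apply: val_inj.
Qed.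

Theorem theorem6p6 (K : fieldType) :
  [/\ multiplicity_free (Z K * (U K)^-1),
      forall n : nat, (1 <= n)%N ->
        #|occurring (Z K * (U K)^-1) n| = #|[set p : sperm n | snakeD p]|,
      multiplicity_free ((1 + Z K) * (U K)^-1)
    & forall n : nat,
        #|occurring ((1 + Z K) * (U K)^-1) n|
          = #|[set p : sperm n | alternating p]| ].
Proof.
have bool01 (b : bool) : b%:R = 0 :> K \/ b%:R = 1 :> K by case: b; [right|left].
(* Complementation turns the [ltn] of the coefficients into the [gtn] of the counting lemmas. *)
have rev_gtn n (u : seq nat) : {in u, forall x, 0 < x <= n}%N ->
    {in u &, forall x y, (n.+1 - x < n.+1 - y)%N = gtn x y}.
  by move=> un x y /un + /un /=; lia.
split.
- by move=> n p; rewrite coef_ZUinv.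
- move=> n n0.
  have -> : occurring (Z K * (U K)^-1) n = [set p | quo_ok ltn (spword p)].
    by apply/setP => p; rewrite !inE coef_ZUinv; case: quo_ok; rewrite ?oner_eq0 ?eqxx.
  under [in RHS]eq_finset do rewrite snakeD_spword.
  apply: card_spword_rev => u uu un su; rewrite -nsign_snakeD ?su //; last first.
    by move=> x /un /andP[].
  rewrite /nsign size_map; apply: eq_count => s; apply: quo_ok_map.
  exact: rev_gtn.
- by move=> n p; rewrite coef_1ZUinv.
move=> n.
have -> : occurring ((1 + Z K) * (U K)^-1) n =
    [set p | inv_ok ltn (spword p) || quo_ok ltn (spword p)].
  by apply/setP => p; rewrite !inE coef_1ZUinv; case: orb; rewrite ?oner_eq0 ?eqxx.
under [in RHS]eq_finset do rewrite alternating_spword.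
apply: (card_spword_rev (P := fun w => inv_ok ltn w || quo_ok ltn w)).
move=> u uu un su; rewrite -nsign_alternating //; last by move=> x /un /andP[].
rewrite /nsign size_map; apply: eq_count => s.
by rewrite (inv_ok_map _ (rev_gtn n u un)) (quo_ok_map _ (rev_gtn n u un)).
Qed.
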